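(* Let $\{T_n\}_{n\ge 1}$ be a sequence of rooted trees, where $T_n$ has $n$ vertices, and let $X_n$ be the random variable counting the number of descents $\mathrm{des}(T_n,w)$ of a labeling $w$ of $T_n$ chosen uniformly at random among all $n!$ labelings. Let $D_n$ be the maximum down-degree of a vertex of $T_n$. If there are a constant $C$ and some $0<\epsilon<\frac12$ such that $D_n\le C n^{\frac12-\epsilon}$ for all $n$, then $\tilde X_n=\frac{X_n-\mathbb{E}(X_n)}{\sqrt{\mathrm{Var}(X_n)}}$ converges in distribution to the standard normal distribution $N(0,1)$ as $n\to\infty$.
   Context: A labeling of a rooted tree $T$ with $n$ vertices is a bijection $w: V(T)\to\{1,\dots,n\}$. A vertex $v$ with parent $u$ is a descent of $(T,w)$ if $w(v)>w(u)$ (the root is never a descent); $\mathrm{des}(T,w)$ is the number of descents. The down-degree of a vertex is its number of children. *)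

(* Defs.v *)
From HB Require Import structures.
From mathcomp Require Import all_boot all_order all_algebra all_fingroup.
From mathcomp Require Import all_classical all_reals all_analysis.
From mathcomp Require Import normal_distribution.
Set Implicit Arguments. Unset Strict Implicit. Unset Printing Implicit Defensive.
Import Order.TTheory GRing.Theory Num.Theory.

(* A rooted tree on the vertex set 'I_n: a root and a parent map such that
   the root is its own (fictitious) parent and every vertex reaches the root
   by iterating the parent map (so there are no other cycles). *)
Record rtree (n : nat) := RTree {
  rt_root : 'I_n;
  rt_parent : 'I_n -> 'I_n;
  rt_parent_root : rt_parent rt_root = rt_root;
  rt_reach : forall v, exists k, iter k rt_parent v = rt_root }.

Definition children n (T : rtree n) (v : 'I_n) : {set 'I_n} :=
  [set u | (u != rt_root T) && (rt_parent T u == v)].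

Definition downdeg n (T : rtree n) (v : 'I_n) : nat := #|children T v|.
Definition maxdowndeg n (T : rtree n) : nat := \max_(v : 'I_n) downdeg T v.

(* A labeling is a bijection V(T) -> {1..n}; we use a permutation of 'I_n
   (labels 0..n-1, an order-preserving shift of 1..n). *)
Definition des n (T : rtree n) (w : {perm 'I_n}) : nat :=
  #|[set v | (v != rt_root T) && (w (rt_parent T v) < w v)]|.

Section Stats.
Context {R : realType}.
Local Open Scope ring_scope.

Definition mean_des n (T : rtree n) : R :=
  (\sum_(w : {perm 'I_n}) (des T w)%:R) / (n`!)%:R.
Definition var_des n (T : rtree n) : R :=
  (\sum_(w : {perm 'I_n}) ((des T w)%:R - mean_des T) ^+ 2) / (n`!)%:R.
Definition std_des n (T : rtree n) (w : {perm 'I_n}) : R :=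
  ((des T w)%:R - mean_des T) / Num.sqrt (var_des T).
Definition cdf_std_des n (T : rtree n) (x : R) : R :=
  (#|[set w : {perm 'I_n} | std_des T w <= x]|)%:R / (n`!)%:R.
End Stats.

(* Main.v *)
Require Import Defs.
From HB Require Import structures.
From mathcomp Require Import all_boot all_order all_algebra all_fingroup.
From mathcomp Require Import all_classical all_reals all_analysis.
From mathcomp Require Import normal_distribution.
From mathcomp Require Import ring lra.
Import Order.TTheory GRing.Theory Num.Theory.
Import numFieldNormedType.Exports.
Local Open Scope classical_set_scope.
Local Open Scope ring_scope.

(* Stein's method. The centred number of descents is a sum of edge variables
   xi_v = [w(parent v) < w v] - 1/2, and xi_v is uncorrelated with every function
   of the labels that is invariant under exchanging the labels of v and its
   parent. So, for W the standardized number of descents and f with f' bounded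
   and Lipschitz, a second-order expansion of f on the edges touching a given
   edge bounds E[f'(W) - W f(W)] by a constant times D / sigma: the error terms
   count pairs of touching edges, whose number is at most 36 sigma^2, with an
   extra factor D for each further touching edge.

   No Stein equation has to be solved. For a smooth cutoff chi decreasing from 1
   at a to 0 at b, put
     f(x) = e^(x^2/2) ((1 - c) Phi(x) chi(x) + c (1 - Phi(x)) (1 - chi(x))),
   so that, with phi0 = 1 / sqrt(2 pi),
     f'(x) - x f(x) = phi0 (chi(x) - c) + e^(x^2/2) (Phi(x) - c) chi'(x).
   The last term is nonnegative for c = Phi(b) and nonpositive for c = Phi(a),
   which gives one-sided bounds of P(W <= x) by values of Phi near x. Mills ratio
   estimates bound f' and f'' in the tails. *)

Set Implicit Arguments. Unset Strict Implicit. Unset Printing Implicit Defensive.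

(** * Averages over permutations *)

Section PermExpectation.
Context {R : realType} {n : nat}.
Implicit Types (F G : {perm 'I_n} -> R) (w s : {perm 'I_n}) (a b c : 'I_n).

Definition Eperm F : R := (\sum_w F w) / (n`!)%:R.

Lemma Eperm_ext F G : F =1 G -> Eperm F = Eperm G.
Proof. by move=> FG; rewrite /Eperm (eq_bigr G). Qed.

Lemma Eperm_cst (k : R) : Eperm (fun=> k) = k.
Proof.
by rewrite /Eperm big_const -Monoid.iteropE /= card_Sn -[X in X / _]mulr_natr mulfK.
Qed.

Lemma EpermD F G : Eperm (fun w => F w + G w) = Eperm F + Eperm G.
Proof. by rewrite /Eperm big_split /= mulrDl. Qed.

Lemma EpermZ (k : R) F : Eperm (fun w => k * F w) = k * Eperm F.
Proof. by rewrite /Eperm -mulr_sumr mulrA. Qed.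

Lemma EpermN F : Eperm (fun w => - F w) = - Eperm F.
Proof. by rewrite /Eperm sumrN mulNr. Qed.

Lemma EpermB F G : Eperm (fun w => F w - G w) = Eperm F - Eperm G.
Proof. by rewrite EpermD EpermN. Qed.

Lemma Eperm_sum (I : finType) (P : pred I) (F : I -> {perm 'I_n} -> R) :
  Eperm (fun w => \sum_(i | P i) F i w) = \sum_(i | P i) Eperm (F i).
Proof. by rewrite /Eperm exchange_big /= mulr_suml. Qed.

Lemma ler_Eperm F G : (forall w, F w <= G w) -> Eperm F <= Eperm G.
Proof.
by move=> FG; rewrite /Eperm ler_wpM2r ?invr_ge0// ler_sum.
Qed.

Lemma ler_norm_Eperm F : `|Eperm F| <= Eperm (fun w => `|F w|).
Proof.
by rewrite /Eperm normrM normfV normr_nat ler_wpM2r ?invr_ge0// ler_norm_sum.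
Qed.

Lemma Eperm_mulg s F : Eperm (fun w => F (s * w)%g) = Eperm F.
Proof.
by rewrite /Eperm [in RHS](reindex_inj (mulgI s)).
Qed.

(** Centring at 1/2 makes this a sign, antisymmetric in [a] and [b] when they differ, with constant
    square 1/4. *)
Definition cmp a b w : R := (w a < w b)%N%:R - 2^-1.

Lemma cmpC a b w : a != b -> cmp b a w = - cmp a b w.
Proof.
move=> ab; have : (w a : nat) != w b by rewrite (inj_eq val_inj) (inj_eq perm_inj).
by rewrite /cmp; case: ltngtP => //= _ _; lra.
Qed.

Lemma cmp_mulg a b s w : cmp a b (s * w)%g = cmp (s a) (s b) w.
Proof. by rewrite /cmp !permM. Qed.

Lemma norm_cmp a b w : `|cmp a b w| = 2^-1.
Proof.
by rewrite /cmp; case: ltnP => _ /=; [rewrite ger0_norm|rewrite ler0_norm]; lra.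
Qed.

Lemma cmp_sqr a b w : cmp a b w * cmp a b w = 4^-1.
Proof. by rewrite /cmp; case: ltnP => _ /=; field. Qed.

(** Exchanging the labels of [a] and [b] preserves averages and [G] but reverses [cmp a b], so the
    average equals its own opposite. *)
Lemma Eperm_cmp a b G : a != b ->
  (forall w, G (tperm a b * w)%g = G w) -> Eperm (fun w => cmp a b w * G w) = 0.
Proof.
move=> ab Gi; set e := Eperm _; suff : e = - e by move=> ?; lra.
rewrite /e -{1}(Eperm_mulg (tperm a b)) -EpermN; apply: Eperm_ext => w.
by rewrite Gi cmp_mulg tpermL tpermR cmpC// mulNr.
Qed.

(* The three signs around a 3-cycle are never all equal, so the cyclic products
   sum to -1/4, and rotating the three labels permutes these products. *)
Lemma Eperm_cmp2 a b c G : a != b -> b != c -> a != c ->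
  (forall w, G (tperm a b * w)%g = G w) ->
  (forall w, G (tperm b c * w)%g = G w) ->
  Eperm (fun w => cmp a b w * cmp b c w * G w) = - 12^-1 * Eperm G.
Proof.
move=> ab bc ac G1 G2.
(* The 3-cycle sending [a] to [c], [c] to [b] and [b] to [a]; it preserves [G] because both
   transpositions do. *)
pose r := (tperm a b * tperm b c)%g.
have Gr w : G (r * w)%g = G w by rewrite /r -mulgA G1 G2.
have ra : r a = c by rewrite permM tpermL tpermL.
have rb : r b = a by rewrite permM tpermR tpermD // eq_sym.
have rc : r c = b by rewrite permM (tpermD ac bc) tpermR.
set e := Eperm _.
have e1 : e = Eperm (fun w => cmp c a w * cmp a b w * G w).
  rewrite /e -(Eperm_mulg r); apply: Eperm_ext => w.
  by rewrite Gr !cmp_mulg ra rb rc.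
have e2 : e = Eperm (fun w => cmp b c w * cmp c a w * G w).
  rewrite e1 -(Eperm_mulg r); apply: Eperm_ext => w.
  by rewrite Gr !cmp_mulg ra rb rc.
have : e + e + e = - 4^-1 * Eperm G.
  rewrite {2}e1 {2}e2 /e -!EpermD -EpermZ; apply: Eperm_ext => w.
  rewrite -!mulrDl; congr (_ * _).
  have : (w a : nat) != w b by rewrite (inj_eq val_inj) (inj_eq perm_inj).
  have : (w b : nat) != w c by rewrite (inj_eq val_inj) (inj_eq perm_inj).
  have : (w a : nat) != w c by rewrite (inj_eq val_inj) (inj_eq perm_inj).
  rewrite /cmp; case: (ltngtP (w a) (w c)) => // h3 _;
   case: (ltngtP (w b) (w c)) => // h2 _; case: (ltngtP (w a) (w b)) => // h1 _ /=;
   try lra.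
  (* The two remaining cases are cyclic orders of the labels, excluded by transitivity. *)
  - by have := ltn_trans h1 (ltn_trans h3 h2); rewrite ltnn.
  - by have := ltn_trans h1 (ltn_trans h2 h3); rewrite ltnn.
by move=> h; lra.
Qed.

End PermExpectation.

(** * Descents as a sum over edges *)

Section DescentTerms.
Context {R : realType} {n : nat} (T : rtree n).
Implicit Types (u v k l : 'I_n) (w : {perm 'I_n}) (G : {perm 'I_n} -> R).

Local Notation p := (rt_parent T).
Local Notation nonroot v := (v != rt_root T).

Lemma parent_neq v : v != rt_root T -> rt_parent T v != v.
Proof.
apply: contra => /eqP pv; have [j] := rt_reach T v.
suff -> : iter j (rt_parent T) v = v by move=> ->.
by elim: j => //= j ->.
Qed.

(** A 2-cycle of the parent map would contain all iterates of [v], hence the root, which is a fixed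
    point. *)
Lemma grandparent_neq v : v != rt_root T -> rt_parent T (rt_parent T v) != v.
Proof.
move=> nv; apply/eqP => ppv.
have it j : iter j (rt_parent T) v = v \/ iter j (rt_parent T) v = rt_parent T v.
  by elim: j => [|j /= [->|->]]; [left|right|left].
have [j] := rt_reach T v; case: (it j) => -> E.
- by move: nv; rewrite E eqxx.
- by move: nv; rewrite -ppv E rt_parent_root eqxx.
Qed.

(* For non-root [u] and [v]: the edges from [u] and [v] to their parents share a
   vertex. The case [u = v] is covered by the first disjunct. *)
Definition touch u v :=
  [|| rt_parent T u == rt_parent T v, rt_parent T u == v | u == rt_parent T v].

Lemma touchC u v : touch u v = touch v u.
Proof.
rewrite /touch (eq_sym (rt_parent T u)) (eq_sym u) (eq_sym (rt_parent T u)).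
by congr (_ || _); rewrite orbC.
Qed.

Definition xi v w : R := cmp (rt_parent T v) v w.

Definition edge_swap v := tperm (rt_parent T v) v.

Definition swap_inv G v := forall w, G (edge_swap v * w)%g = G w.

Lemma xi_swap u v : ~~ touch u v -> swap_inv (xi u) v.
Proof.
rewrite /touch !negb_or => /and3P[h1 h2 h3] w.
have h4 : u != v by apply: contraNneq h1 => ->.
by rewrite /xi cmp_mulg !tpermD // eq_sym.
Qed.

Lemma norm_xi v w : `|xi v w| = 2^-1. Proof. exact: norm_cmp. Qed.

Lemma Eperm_xi v G : nonroot v -> swap_inv G v ->
  Eperm (fun w => xi v w * G w) = 0.
Proof. by move=> nv Gv; apply: Eperm_cmp => //; exact: parent_neq. Qed.

(* 1/4 for [u = v] (which also share their parent), 1/12 for siblings, -1/12 for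
   a vertex and its parent. *)
Definition xicov u v : R :=
  (u == v)%:R / 6 + (p u == p v)%:R / 12 - (p u == v)%:R / 12
  - (u == p v)%:R / 12.

Lemma xicov_touch u v : ~~ touch u v -> xicov u v = 0.
Proof.
rewrite /touch !negb_or => /and3P[h1 h2 h3].
have h4 : u != v by apply: contraNneq h1 => ->.
by rewrite /xicov (negPf h1) (negPf h2) (negPf h3) (negPf h4) /=; ring.
Qed.

Lemma Eperm_chain u v G : u = p v -> nonroot u -> nonroot v ->
  swap_inv G u -> swap_inv G v ->
  Eperm (fun w => xi u w * xi v w * G w) = - 12^-1 * Eperm G.
Proof.
move=> -> nu nv Gu Gv; apply: Eperm_cmp2.
- exact: parent_neq.
- exact: parent_neq.
- exact: grandparent_neq.
- exact: Gu.
- exact: Gv.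
Qed.

(** The weight [G] will be a centred product over two edges that touch neither [u] nor [v]. *)
Lemma Eperm_xi2 u v G : nonroot u -> nonroot v -> touch u v ->
  swap_inv G u -> swap_inv G v ->
  Eperm (fun w => xi u w * xi v w * G w) = xicov u v * Eperm G.
Proof.
move=> nu nv t Gu Gv; rewrite /xicov.
have [puv|npuv] := eqVneq (p u) (p v).
  have -> : (p u == v) = false by rewrite puv; exact/negbTE/parent_neq.
  have -> : (u == p v) = false.
    by rewrite -puv eq_sym; exact/negbTE/parent_neq.
  have [uv|uv] := eqVneq u v.
    by rewrite -EpermZ; apply: Eperm_ext => w; rewrite uv cmp_sqr /=; field.
  (* For siblings, reversing the edge of [u] gives the path [u], [p u], [v] at the price of a sign,
     hence +1/12. *)
  rewrite -[LHS]opprK -EpermN.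
  have -> : Eperm (fun w => - (xi u w * xi v w * G w)) =
            Eperm (fun w => cmp u (p u) w * cmp (p u) v w * G w).
    apply: Eperm_ext => w; rewrite /xi (@cmpC _ _ (p u) u); last exact: parent_neq.
    by rewrite puv !mulNr.
  rewrite Eperm_cmp2 //=; first by field.
  - by rewrite eq_sym; exact: parent_neq.
  - by rewrite puv; exact: parent_neq.
  - by move=> w; rewrite tpermC; exact: Gu.
  - by move=> w; rewrite puv; exact: Gv.
have uv : (u == v) = false by apply/negbTE; apply: contraNneq npuv => ->.
rewrite uv; move: t; rewrite /touch (negPf npuv) /=.
have [puv _|_ /= /eqP upv] := eqVneq (p u) v.
  have -> : (u == p v) = false.
    by rewrite -puv eq_sym; exact/negbTE/grandparent_neq.
  have -> : Eperm (fun w => xi u w * xi v w * G w) =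
            Eperm (fun w => xi v w * xi u w * G w).
    by apply: Eperm_ext => w; rewrite (mulrC (xi u w)).
  by rewrite Eperm_chain //=; field.
by rewrite Eperm_chain //= upv eqxx /=; field.
Qed.

Lemma Eperm_xixi u v : nonroot u -> nonroot v ->
  Eperm (fun w => xi u w * xi v w) = xicov u v.
Proof.
move=> nu nv; have [t|t] := boolP (touch u v).
  rewrite -[RHS]mulr1 -(@Eperm_cst R n 1) -(@Eperm_xi2 _ _ (fun=> 1)) //.
  by apply: Eperm_ext => w; rewrite mulr1.
by rewrite xicov_touch// Eperm_xi //; apply: xi_swap; rewrite touchC.
Qed.

Lemma norm_xicov u v : nonroot u -> nonroot v -> `|xicov u v| <= 4^-1.
Proof.
move=> nu nv; rewrite -Eperm_xixi//; apply: le_trans (ler_norm_Eperm _) _.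
rewrite -[leRHS](@Eperm_cst R n); apply: ler_Eperm => w.
by rewrite normrM !norm_xi; lra.
Qed.

Definition devn w : R := \sum_(v | nonroot v) xi v w.

Lemma des_devn w : (des T w)%:R = devn w + (\sum_(v | nonroot v) 2^-1).
Proof.
rewrite /devn -big_split /= /des -sum1_card natr_sum big_mkcond [RHS]big_mkcond /=.
apply: eq_bigr => v _; rewrite inE /xi /cmp.
by case: (nonroot v) => //=; case: ifP => _ /=; lra.
Qed.

Lemma mean_desE : mean_des T = \sum_(v | nonroot v) 2^-1 :> R.
Proof.
have -> : mean_des T = Eperm (fun w => (des T w)%:R) :> R by [].
rewrite (Eperm_ext des_devn) EpermD Eperm_cst Eperm_sum big1 ?add0r// => v nv.
by rewrite -(@Eperm_xi v (fun=> 1))//; apply: Eperm_ext => w; rewrite mulr1.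
Qed.

Lemma des_mean w : (des T w)%:R - mean_des T = devn w.
Proof. by rewrite mean_desE des_devn addrK. Qed.

Lemma var_desE : var_des T = Eperm (fun w => devn w ^+ 2) :> R.
Proof.
by rewrite /var_des /Eperm; congr (_ / _); apply: eq_bigr => w _; rewrite des_mean.
Qed.

Lemma var_des_xicov :
  var_des T = \sum_(u | nonroot u) \sum_(v | nonroot v) xicov u v :> R.
Proof.
rewrite var_desE.
transitivity (Eperm (fun w => \sum_(u | nonroot u) \sum_(v | nonroot v) xi u w * xi v w)).
  apply: Eperm_ext => w; rewrite expr2 mulr_suml; apply: eq_bigr => u _.
  by rewrite mulr_sumr.
rewrite Eperm_sum; apply: eq_bigr => u nu; rewrite Eperm_sum.
by apply: eq_bigr => v nv; rewrite Eperm_xixi.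
Qed.

Lemma downdegE v : (downdeg T v)%:R = \sum_(u | nonroot u) (p u == v)%:R :> R.
Proof.
rewrite /downdeg -sum1_card natr_sum big_mkcond [RHS]big_mkcond /=.
apply: eq_bigr => u _; rewrite inE.
by case: (nonroot u) => //=; case: (p u == v).
Qed.

Lemma sum_eq_le1 (Q : pred 'I_n) a : \sum_(v | Q v) (a == v)%:R <= 1 :> R.
Proof.
have [h|h] := boolP (Q a).
  by rewrite (bigD1 a)//= eqxx big1 ?addr0// => v /andP[_ /negPf]; rewrite eq_sym => ->.
by rewrite big1 // => v Qv; case: eqP => // av; rewrite av Qv in h.
Qed.

(** After exchanging the sums, each non-root [u] counts once, at its parent, or not at all if that
    parent is the root. *)
Lemma sum_downdeg_le :
  \sum_(v | nonroot v) (downdeg T v)%:R <= \sum_(v | nonroot v) 1 :> R.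
Proof.
under eq_bigr do rewrite downdegE.
rewrite exchange_big /=; apply: ler_sum => u _.
exact: sum_eq_le1.
Qed.

Lemma sum_nonroot_le :
  \sum_(v | nonroot v) 1 <= \sum_(v | nonroot v) (downdeg T (p v))%:R :> R.
Proof.
apply: ler_sum => v nv; rewrite ler1n card_gt0; apply/set0Pn.
by exists v; rewrite inE nv /= eqxx.
Qed.

(** Let a, b, c be the sums over non-root [v] of [downdeg T (p v)], [downdeg T v] and 1. Summing
    [xicov] by rows gives 12 Var >= 2c + a - b - c, and b <= c. *)
Lemma var_des_ge :
  \sum_(v | nonroot v) (downdeg T (p v))%:R <= 12 * var_des T :> R.
Proof.
rewrite var_des_xicov.
have : \sum_(u | nonroot u) (6^-1 + (downdeg T (p u))%:R / 12
   - (downdeg T u)%:R / 12 - 12^-1) <=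
  \sum_(u | nonroot u) \sum_(v | nonroot v) xicov u v :> R.
  apply: ler_sum => u nu.
  rewrite /xicov !big_split /= !sumrN -!mulr_suml !downdegE.
  have -> : \sum_(v | nonroot v) (u == v)%:R = 1 :> R.
    by rewrite (bigD1 u)//= eqxx big1 ?addr0// => v /andP[_ /negPf]; rewrite eq_sym => ->.
  have -> : \sum_(v | nonroot v) (p u == p v)%:R =
     \sum_(v | nonroot v) (p v == p u)%:R :> R.
    by apply: eq_bigr => v _; rewrite eq_sym.
  have -> : \sum_(v | nonroot v) (u == p v)%:R =
     \sum_(v | nonroot v) (p v == u)%:R :> R.
    by apply: eq_bigr => v _; rewrite eq_sym.
  have h := sum_eq_le1 (fun v => nonroot v) (p u).
  by lra.
rewrite !big_split /= !sumrN -!mulr_suml.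
have := sum_downdeg_le; have := sum_nonroot_le.
rewrite -[6^-1]mul1r -[12^-1]mul1r -!mulr_suml.
move: (\sum_(_ | _) (\sum_(_ | _) _)) => V.
move: (\sum_(v | nonroot v) (downdeg T (p v))%:R) => a.
move: (\sum_(v | nonroot v) (downdeg T v)%:R) => b.
move: (\sum_(v | nonroot v) 1) => c.
by move=> *; lra.
Qed.

(** A non-root [v] is counted too, since [touch v v] holds. *)
Definition touchdeg v : R := \sum_(u | nonroot u) (touch v u)%:R.

Lemma touchdeg_le v : touchdeg v <= (downdeg T (p v))%:R + (downdeg T v)%:R + 1.
Proof.
rewrite !downdegE.
have h := sum_eq_le1 (fun v => nonroot v) (p v).
apply: le_trans (lerD (lexx _) h); rewrite -!big_split /=; apply: ler_sum => u nu.
rewrite /touch (eq_sym (p v) (p u)) (eq_sym v).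
by do 3 case: (_ == _) => //=; lra.
Qed.

(** The three sums bounding the left side satisfy b <= c <= a <= 12 Var. *)
Lemma sum_touchdeg_le : \sum_(v | nonroot v) touchdeg v <= 36 * var_des T.
Proof.
have h : \sum_(v | nonroot v) touchdeg v <=
   \sum_(v | nonroot v) ((downdeg T (p v))%:R + (downdeg T v)%:R + 1).
  by apply: ler_sum => v _; exact: touchdeg_le.
move: h; rewrite !big_split /=.
have := sum_downdeg_le; have := sum_nonroot_le; have := var_des_ge.
move: (\sum_(v | nonroot v) (downdeg T (p v))%:R) => a.
move: (\sum_(v | nonroot v) (downdeg T v)%:R) => b.
move: (\sum_(v | nonroot v) 1) => c.
by move=> *; lra.
Qed.

End DescentTerms.

(** * Stein's bound *)

Section SteinBound.
Context {R : realType} {n : nat} (T : rtree n).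
Implicit Types (u v k l : 'I_n) (w : {perm 'I_n}) (G : {perm 'I_n} -> R).
Local Notation nonroot v := (v != rt_root T).
Local Notation xi := (@xi R n T).

Definition localsum v w : R := \sum_(u | nonroot u && touch T v u) xi u w.

(** Its average is the variance, since edges that do not touch are uncorrelated. *)
Definition quadsum w : R := \sum_(v | nonroot v) xi v w * localsum v w.

Definition quadterm v u w : R := xi v w * xi u w - xicov T v u.

Lemma quadsum_var w : quadsum w - var_des T =
  \sum_(v | nonroot v) \sum_(u | nonroot u && touch T v u) quadterm v u w.
Proof.
rewrite /quadsum var_des_xicov -sumrB; apply: eq_bigr => v _.
rewrite mulr_sumr /quadterm [RHS]sumrB; congr (_ - _).
rewrite [RHS]big_mkcondr; apply: eq_bigr => u _.
by case: ifPn => // ?; rewrite xicov_touch.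
Qed.

Lemma swap_inv_quadterm v u k : ~~ touch T v k -> ~~ touch T u k ->
  swap_inv T (quadterm v u) k.
Proof. by move=> vk uk w; rewrite /quadterm !xi_swap. Qed.

(** If no edge of the first pair touches one of the second, the second factor is an invariant weight
    for the first and the average vanishes. Otherwise each factor is at most 1/2 in absolute value
    and some indicator equals 1. *)
Lemma Eperm_quadterm2 v u k l : nonroot v -> nonroot u -> nonroot k -> nonroot l ->
  touch T v u ->
  Eperm (fun w => quadterm v u w * quadterm k l w) <=
  4^-1 * ((touch T v k)%:R + (touch T v l)%:R + (touch T u k)%:R + (touch T u l)%:R).
Proof.
move=> nv nu nk nl vu.
have [|] := boolP [|| touch T v k, touch T v l, touch T u k | touch T u l].
  move=> tt.
  have q i j w : nonroot i -> nonroot j -> `|quadterm i j w| <= 2^-1.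
    move=> ni nj; apply: le_trans (ler_normB _ _) _.
    rewrite normrM !norm_xi; have hc := @norm_xicov R _ _ _ _ ni nj; lra.
  apply: (@le_trans _ _ 4^-1).
    apply: le_trans (ler_norm _) _; apply: le_trans (ler_norm_Eperm _) _.
    rewrite -[leRHS](@Eperm_cst R n); apply: ler_Eperm => w; rewrite normrM.
    have := q v u w nv nu; have := q k l w nk nl.
    have := normr_ge0 (quadterm v u w); have := normr_ge0 (quadterm k l w).
    by move: `|_| `|_| => x y *; nra.
  move: tt; do 4 case: (touch _ _ _) => //=; lra.
rewrite 3!negb_or => /and4P[vk vl uk ul].
rewrite (negPf vk) (negPf vl) (negPf uk) (negPf ul) /=.
rewrite [leRHS](_ : _ = 0); last by lra.
have Gv : swap_inv T (quadterm k l) v by apply: swap_inv_quadterm; rewrite touchC.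
have Gu : swap_inv T (quadterm k l) u by apply: swap_inv_quadterm; rewrite touchC.
rewrite (@Eperm_ext R n _ (fun w => xi v w * xi u w * quadterm k l w -
   xicov T v u * quadterm k l w)); last by move=> w; rewrite /quadterm mulrBl.
by rewrite EpermB EpermZ Eperm_xi2// subrr.
Qed.

Context (B : R).
Hypothesis touchdegB : forall v, nonroot v -> touchdeg T v <= B.

Lemma touchdegE v :
  touchdeg T v = \sum_(u | nonroot u && touch T v u) 1 :> R.
Proof.
rewrite [RHS]big_mkcondr; apply: eq_bigr => u _.
by case: (touch _ _ _).
Qed.

(** At most [B] choices of [k] touch [v], and then at most [B] choices of [l] touch [k]. *)
Lemma sum_touch_pairs v : nonroot v ->
  \sum_(k | nonroot k) \sum_(l | nonroot l && touch T k l) (touch T v k)%:R <= B ^+ 2 :> R.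
Proof.
move=> nv; have B0 : 0 <= B.
  by apply: le_trans (touchdegB nv); rewrite sumr_ge0.
apply: (@le_trans _ _ (\sum_(k | nonroot k) (touch T v k)%:R * B)).
  apply: ler_sum => k nk.
  under eq_bigr do rewrite -[_%:R]mulr1.
  by rewrite -mulr_sumr -touchdegE ler_wpM2l// touchdegB.
by rewrite -mulr_suml expr2 ler_wpM2r// touchdegB.
Qed.

Lemma sum_touch_pairs_sym v : nonroot v ->
  \sum_(k | nonroot k) \sum_(l | nonroot l && touch T k l) (touch T v l)%:R <= B ^+ 2 :> R.
Proof.
move=> nv; apply: le_trans (sum_touch_pairs nv).
rewrite (exchange_big_dep (fun l => nonroot l)) /=; last by move=> ? ? _ /andP[].
apply: ler_sum => k nk; rewrite le_eqVlt; apply/predU1P; left; apply: eq_bigl => l.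
by rewrite nk touchC.
Qed.

(** Expanding the square, each touching pair [v], [u] meets four families of pairs [k], [l], each of
    size at most [B ^+ 2] with weight 1/4. The touching pairs themselves number at most 36 Var. *)
Lemma Eperm_quadsum :
  Eperm (fun w => (quadsum w - var_des T) ^+ 2) <= 36 * B ^+ 2 * var_des T.
Proof.
rewrite (@Eperm_ext R n _ (fun w => \sum_(v | nonroot v)
   \sum_(u | nonroot u && touch T v u) \sum_(k | nonroot k)
    \sum_(l | nonroot l && touch T k l) quadterm v u w * quadterm k l w)); last first.
  move=> w; rewrite quadsum_var expr2 mulr_suml; apply: eq_bigr => v _.
  rewrite mulr_suml; apply: eq_bigr => u _.
  rewrite mulr_sumr; apply: eq_bigr => k _.
  by rewrite mulr_sumr.
rewrite Eperm_sum.
apply: (@le_trans _ _ (\sum_(v | nonroot v) B ^+ 2 * touchdeg T v)); last first.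
  rewrite -mulr_sumr [leRHS](_ : _ = B ^+ 2 * (36 * var_des T)); last by ring.
  by rewrite ler_wpM2l ?sqr_ge0// sum_touchdeg_le.
apply: ler_sum => v nv; rewrite Eperm_sum touchdegE mulr_sumr.
apply: ler_sum => u /andP[nu vu]; rewrite Eperm_sum mulr1.
apply: (@le_trans _ _ (\sum_(k | nonroot k) \sum_(l | nonroot l && touch T k l)
   4^-1 * ((touch T v k)%:R + (touch T v l)%:R + (touch T u k)%:R + (touch T u l)%:R))).
  apply: ler_sum => k nk; rewrite Eperm_sum; apply: ler_sum => l /andP[nl _].
  exact: Eperm_quadterm2.
under eq_bigr do rewrite -mulr_sumr !big_split /=.
rewrite -mulr_sumr !big_split /=.
have := sum_touch_pairs nv; have := sum_touch_pairs nu.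
have := sum_touch_pairs_sym nv; have := sum_touch_pairs_sym nu.
move: (\sum_(_ | _) _) (\sum_(_ | _) _) (\sum_(_ | _) _) (\sum_(_ | _) _) => a b c d.
by move=> *; lra.
Qed.

Lemma swap_inv_rest v : swap_inv T (fun w => devn T w - localsum v w) v.
Proof.
have E w : devn T w - localsum v w = \sum_(u | nonroot u && ~~ touch T v u) xi u w.
  rewrite /devn (bigID (fun u => touch T v u)) /= -/(localsum v w).
  by rewrite addrAC subrr add0r.
move=> w; rewrite !E; apply: eq_bigr => u /andP[_ vu].
by rewrite xi_swap // touchC.
Qed.

Lemma norm_localsum v w : nonroot v -> `|localsum v w| <= B / 2.
Proof.
move=> nv; apply: le_trans (ler_norm_sum _ _ _) _.
under eq_bigr do rewrite norm_xi -[2^-1]mul1r.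
by rewrite -mulr_suml -touchdegE ler_wpM2r// touchdegB.
Qed.

(* One factor [touchdeg] is not bounded by [B]: its sum is at most [36 * var_des]. *)
Lemma sqr_localsum v w : nonroot v -> localsum v w ^+ 2 <= B * touchdeg T v / 4.
Proof.
move=> nv; have h := norm_localsum w nv.
have h' : `|localsum v w| <= touchdeg T v / 2.
  apply: le_trans (ler_norm_sum _ _ _) _.
  under eq_bigr do rewrite norm_xi -[2^-1]mul1r.
  by rewrite -mulr_suml -touchdegE.
rewrite -real_normK ?num_real// expr2.
move: h h' (normr_ge0 (localsum v w)); move: `|_| => x h1 h2 h0.
nra.
Qed.

(** Removing [localsum v] from [devn] inside [f] leaves a function uncorrelated with [xi v];
    expanding around [W] turns E[W f(W)] into E[f'(W) [quadsum]] / Var plus a remainder. The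
    constant is 23 = 9/2 + 37/2, from the remainder and from the fluctuation of [quadsum]. *)
Lemma stein_bound (f f' : R -> R) (K : R) : 0 < var_des T :> R ->
  (forall a, `|f' a| <= K) ->
  (forall a h, `|f (a + h) - f a - f' a * h| <= K * h ^+ 2) ->
  `|Eperm (fun w => f' (std_des T w) - std_des T w * f (std_des T w))| <=
  23 * K * B / Num.sqrt (var_des T).
Proof.
move=> var0 f'K fK; set s := Num.sqrt _; set s2 := var_des T in var0 *.
have s0 : 0 < s by rewrite sqrtr_gt0.
have ss : s ^+ 2 = s2 by rewrite sqr_sqrtr// ltW.
have K0 : 0 <= K by apply: le_trans (f'K 0).
have B0 : 0 <= B.
  have [/pred0P h|/pred0Pn[v nv]] := boolP (pred0b (fun v => nonroot v)).
    by move: var0; rewrite /s2 var_des_xicov big_pred0// ltxx.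
  by apply: le_trans (touchdegB nv); rewrite sumr_ge0.
pose W w := devn T w / s.
rewrite (@Eperm_ext R n _ (fun w => f' (W w) - W w * f (W w))); last first.
  by move=> w; rewrite /std_des des_mean.
pose r v w := f (W w) - f (W w - localsum v w / s) - f' (W w) * (localsum v w / s).
have rb v w : `|r v w| <= K * (localsum v w / s) ^+ 2.
  have := fK (W w) (- (localsum v w / s)); rewrite sqrrN -normrN.
  by congr (`|_| <= _); rewrite /r; ring.
have E1 : Eperm (fun w => W w * f (W w)) =
   Eperm (fun w => f' (W w) * quadsum w / s2) +
   Eperm (fun w => \sum_(v | nonroot v) xi v w * r v w) / s.
  rewrite [X in _ = _ + X]mulrC -EpermZ -EpermD.
  (* The two sides differ by a sum of averages of [xi v w * f (W w - localsum v w / s)], all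
     zero. *)
  apply/eqP; rewrite -subr_eq0 -EpermB; apply/eqP.
  rewrite (@Eperm_ext R n _ (fun w => \sum_(v | nonroot v)
      s^-1 * (xi v w * f (W w - localsum v w / s)))).
    rewrite Eperm_sum big1 // => v nv; rewrite EpermZ Eperm_xi ?mulr0// => w.
    by congr (f _); rewrite /W -!mulrBl; congr (_ / _); exact: swap_inv_rest.
  move=> w; rewrite {1}/W {1}/devn /quadsum -ss -mulrA mulr_suml mulr_sumr !mulr_suml.
  rewrite mulr_sumr -big_split -sumrB /=; apply: eq_bigr => v _.
  by rewrite /r; field; rewrite gt_eqF.
rewrite EpermB E1 opprD addrA -EpermB.
(* 9/2 is 36/8: 36 from the sum of [touchdeg], 1/2 from [norm_xi] and 1/4 from [sqr_localsum]. *)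
have R1 : `|Eperm (fun w => \sum_(v | nonroot v) xi v w * r v w) / s|
   <= 9 / 2 * K * B / s.
  rewrite normrM normfV (gtr0_norm s0) ler_pM2r ?invr_gt0//.
  apply: le_trans (ler_norm_Eperm _) _.
  rewrite -[leRHS](@Eperm_cst R n); apply: ler_Eperm => w.
  apply: le_trans (ler_norm_sum _ _ _) _.
  apply: (@le_trans _ _ (\sum_(v | nonroot v) K * B / (8 * s2) * touchdeg T v)).
    apply: ler_sum => v nv; rewrite normrM norm_xi.
    have := rb v w; rewrite expr_div_n ss.
    have := sqr_localsum w nv; move: `|_| => x h1 h2.
    have : K * (localsum v w ^+ 2 / s2) <= K * (B * touchdeg T v / 4 / s2).
      by rewrite ler_wpM2l// ler_wpM2r// invr_ge0 ltW.
    have -> : K * (B * touchdeg T v / 4 / s2) = 2 * (K * B / (8 * s2) * touchdeg T v).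
      by field; rewrite gt_eqF.
    by move=> h3; lra.
  rewrite -mulr_sumr; apply: (@le_trans _ _ (K * B / (8 * s2) * (36 * s2))).
    rewrite ler_wpM2l// ?sum_touchdeg_le//.
    by rewrite !mulr_ge0// invr_ge0 mulr_ge0// ltW.
  by rewrite le_eqVlt; apply/predU1P; left; field; rewrite gt_eqF.
(* 37/2 is (36 + 1)/2, from the two terms of the arithmetic-geometric inequality. *)
have R2 : `|Eperm (fun w => f' (W w) - f' (W w) * quadsum w / s2)| <= 37 / 2 * K * B / s.
  (* The parameter t = B s must be positive; for [B = 0] there are no touching pairs and [quadsum]
     is the variance. *)
  have [B00|Bp] := eqVneq B 0.
    have z w : quadsum w - s2 = 0.
      rewrite quadsum_var big1 // => v nv; rewrite big1 // => u /andP[nu vu].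
      have : touchdeg T v <= B by exact: touchdegB.
      rewrite B00 leNgt => /negP[]; rewrite /touchdeg (bigD1 u)//= vu.
      by rewrite ltr_pwDl// sumr_ge0.
    rewrite (@Eperm_ext R n _ (fun=> 0)).
      by rewrite Eperm_cst normr0 !mulr_ge0// invr_ge0 ltW.
    move=> w; move/eqP: (z w); rewrite subr_eq0 => /eqP ->.
    by rewrite mulfK ?subrr// gt_eqF.
  have {}Bp : 0 < B by rewrite lt_neqAle eq_sym Bp.
  apply: le_trans (ler_norm_Eperm _) _.
  (* AM-GM: |x| <= (x^2/t + t)/2 with t = B s *)
  apply: (@le_trans _ _ (Eperm (fun w => K / (2 * s2) *
     ((quadsum w - s2) ^+ 2 / (B * s) + B * s)))).
    apply: ler_Eperm => w.
    have -> : f' (W w) - f' (W w) * quadsum w / s2 = f' (W w) * (s2 - quadsum w) / s2.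
      by field; rewrite gt_eqF.
    rewrite !normrM normfV (gtr0_norm var0) distrC.
    set x := quadsum w - s2; set t := B * s.
    have t0 : 0 < t by rewrite mulr_gt0.
    have amgm : `|x| <= (x ^+ 2 / t + t) / 2.
      rewrite ler_pdivlMr// -(ler_pM2r t0) mulrDl divfK ?gt_eqF//.
      rewrite -[x ^+ 2]real_normK ?num_real//.
      by have := sqr_ge0 (`|x| - t); move: `|x| => y h; nra.
    rewrite [leRHS](_ : _ = K * ((x ^+ 2 / t + t) / 2) / s2); last first.
      by field; rewrite !gt_eqF.
    by rewrite ler_pM2r ?invr_gt0// ler_pM.
  rewrite EpermZ EpermD Eperm_cst.
  rewrite (@Eperm_ext R n _ (fun w => (B * s)^-1 * (quadsum w - s2) ^+ 2)); last first.
    by move=> w; rewrite mulrC.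
  rewrite EpermZ.
  apply: (@le_trans _ _ (K / (2 * s2) * ((B * s)^-1 * (36 * B ^+ 2 * s2) + B * s))).
    apply: ler_wpM2l; first by rewrite divr_ge0// mulr_ge0// ltW.
    rewrite lerD2r; apply: ler_wpM2l; last exact: Eperm_quadsum.
    by rewrite invr_ge0 mulr_ge0// ltW.
  by rewrite le_eqVlt; apply/predU1P; left; rewrite -ss; field; rewrite !gt_eqF.
apply: le_trans (ler_normB _ _) _.
apply: le_trans (lerD R2 R1) _.
by rewrite le_eqVlt; apply/predU1P; left; field; rewrite gt_eqF.
Qed.

End SteinBound.

(** * The Gaussian distribution function *)

Section GaussianCdf.
Context {R : realType}.
Implicit Types x y w : R.
Local Notation mu := (@lebesgue_measure R).

Definition Phi x : R := fine (normal_prob (0 : R) 1 `]-oo, x]).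

Definition phi0 : R := normal_peak (1 : R).

Lemma phi0_gt0 : 0 < phi0. Proof. by rewrite normal_peak_gt0 ?oner_neq0. Qed.

Lemma PhiE x : normal_prob (0 : R) 1 `]-oo, x] = (Phi x)%:E.
Proof. by rewrite /Phi fineK// fin_num_measure. Qed.

Lemma Phi_ge0 x : 0 <= Phi x. Proof. by rewrite fine_ge0. Qed.

Lemma Phi_le1 x : Phi x <= 1.
Proof. by rewrite -lee_fin -PhiE probability_le1. Qed.

Lemma Phi_mono x y : x <= y -> Phi x <= Phi y.
Proof.
move=> xy; rewrite -lee_fin -!PhiE le_measure ?inE//.
exact: subitvPr.
Qed.

Lemma normal_pdf01 x : normal_pdf 0 1 x = phi0 * expR (- (x ^+ 2 / 2)) :> R.
Proof.
rewrite normal_pdfE ?oner_neq0// /normal_fun subr0 expr1n mulNr.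
by [].
Qed.

(** The fundamental theorem of calculus on a half-line ending beyond [x], as the density is
    continuous. *)
Lemma is_derive_Phi x : is_derive x 1 Phi (phi0 * expR (- (x ^+ 2 / 2))).
Proof.
have xx : x < x + 1 by rewrite ltrDl.
have I : mu.-integrable `]-oo, (x + 1)] (EFin \o normal_pdf (0 : R) 1).
  by apply: (integrableS _ _ (@subsetT _ _)) => //; exact: integrable_normal_pdf.
have [D1 D2] := @continuous_FTC1 R (normal_pdf 0 1) (BInfty _ true) x _ xx I
  (ltNyr _) (@continuous_normal_pdf R 0 1 (oner_neq0 _) x).
apply: DeriveDef; first exact: D1.
by rewrite -derive1E -normal_pdf01; exact: D2.
Qed.

(** Under the normal law the identity is a random variable with distribution function [Phi], so
    general facts on distribution functions give the limits of [Phi]. *)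
Let idTR : measurableTypeR R -> R := idfun.

#[local] HB.instance Definition _ :=
  @isMeasurableFun.Build _ _ _ _ idTR (@measurable_id _ _ setT).

Let cdf_idTR : cdf (idTR : {RV (normal_prob (0 : R) 1) >-> R}) = EFin \o Phi.
Proof. by apply/funext => x; rewrite /cdf /distribution /pushforward preimage_id /= -PhiE. Qed.

Lemma Phi_cvgy : Phi x @[x --> +oo] --> (1 : R).
Proof.
have := cvg_cdfy1 (idTR : {RV (normal_prob (0 : R) 1) >-> R}).
by rewrite cdf_idTR => /fine_cvg.
Qed.

Lemma Phi_cvgNy : Phi x @[x --> -oo] --> (0 : R).
Proof.
have := cvg_cdfNy0 (idTR : {RV (normal_prob (0 : R) 1) >-> R}).
by rewrite cdf_idTR => /fine_cvg.
Qed.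

End GaussianCdf.

(** * Differentiation rules and tail estimates *)

Section Calculus.
Context {R : realType}.
Implicit Types (f g : R -> R) (x a b : R).

(** These rules are stated for pointwise expressions, so that they compose as terms and leave one
    algebraic identity to check. *)
Lemma is_derive1D f g x a b : is_derive x 1 f a -> is_derive x 1 g b ->
  is_derive x 1 (fun y => f y + g y) (a + b).
Proof. exact: is_deriveD. Qed.

Lemma is_derive1B f g x a b : is_derive x 1 f a -> is_derive x 1 g b ->
  is_derive x 1 (fun y => f y - g y) (a - b).
Proof. exact: is_deriveB. Qed.

Lemma is_derive1M f g x a b : is_derive x 1 f a -> is_derive x 1 g b ->
  is_derive x 1 (fun y => f y * g y) (f x * b + g x * a).
Proof. exact: is_deriveM. Qed.

Lemma is_derive1N f x a : is_derive x 1 f a -> is_derive x 1 (fun y => - f y) (- a).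
Proof. exact: is_deriveN. Qed.

Lemma is_derive1_cst x a : is_derive x 1 (fun=> a) 0.
Proof. exact: is_derive_cst. Qed.

Lemma is_derive1_id x : is_derive x 1 (fun y => y) (1 : R).
Proof. exact: is_derive_id. Qed.

Lemma is_derive1_continuous f x a : is_derive x 1 f a -> {for x, continuous f}.
Proof. by move=> [df _]; apply/differentiable_continuous/derivable1_diffP. Qed.

Lemma is_derive_gauss x : is_derive x 1 (fun y => expR (y ^+ 2 / 2)) (x * expR (x ^+ 2 / 2)).
Proof.
have h : is_derive x 1 (fun y : R => y ^+ 2 / 2) x.
  apply: is_derive_eq (is_derive1M (is_derive1M (is_derive1_id x) (is_derive1_id x))
    (is_derive1_cst x 2^-1)) _.
  by field.
have := @is_derive1_comp _ expR _ x _ _ (is_derive_expR _) h.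
by move=> H; apply: is_derive_eq H _; rewrite mulrC.
Qed.

Lemma is_derive_gaussN x :
  is_derive x 1 (fun y => expR (- (y ^+ 2 / 2))) (- x * expR (- (x ^+ 2 / 2))).
Proof.
have h : is_derive x 1 (fun y : R => - (y ^+ 2 / 2)) (- x).
  apply: is_derive_eq (is_derive1N (is_derive1M (is_derive1M (is_derive1_id x)
    (is_derive1_id x)) (is_derive1_cst x 2^-1))) _.
  by field.
have := @is_derive1_comp _ expR _ x _ _ (is_derive_expR _) h.
by move=> H; apply: is_derive_eq H _; rewrite mulrC.
Qed.

Lemma nonincreasing_cvg0_ge0 (g g' : R -> R) a :
  (forall x, a <= x -> is_derive x 1 g (g' x)) ->
  (forall x, a <= x -> g' x <= 0) -> g x @[x --> +oo] --> (0 : R) -> 0 <= g a.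
Proof.
move=> dg g'0 g0.
apply: (cvgr_to_le g0); near=> y.
have ay : a <= y by near: y; apply: nbhs_pinfty_ge; rewrite num_real.
apply: (@ler0_derive1_nincry _ g a) => // [x|x|].
- by rewrite in_itv/= andbT => /ltW /dg [].

- by rewrite in_itv/= andbT => /ltW ax; rewrite derive1E; have [_ ->] := dg _ ax; exact: g'0.
- by apply: derivable_within_continuous => x; rewrite in_itv/= andbT => /dg [].
Unshelve. all: by end_near. Qed.

(** Squeezed below a multiple of exp(-x), since x^2/2 >= x for x >= 2. *)
Lemma gauss_tail_cvg0 (r : R -> R) :
  (forall x, 1 <= x -> 0 <= r x <= phi0 * expR (- (x ^+ 2 / 2))) ->
  r x @[x --> +oo] --> (0 : R).
Proof.
move=> hr.
apply: (@squeeze_cvgr _ _ _ _ (fun=> 0) (fun x => phi0 * expR (- x))).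
- near=> x.
  have x2 : 2 <= x by near: x; apply: nbhs_pinfty_ge; rewrite num_real.
  have /andP[-> h] /= : 0 <= r x <= phi0 * expR (- (x ^+ 2 / 2)).
    by apply: hr; apply: le_trans x2; rewrite ler1n.
  apply: le_trans h _; rewrite ler_pM2l ?phi0_gt0// ler_expR.
  by nra.
- exact: cvg_cst.
- rewrite -[X in _ --> X](mulr0 (phi0 : R)); apply: cvgM; first exact: cvg_cst.
  exact: cvgr_expR.
Unshelve. all: by end_near. Qed.

(** * Mills ratio estimates *)

Section Mills.
(** [G] stands for either tail, [1 - Phi x] or [Phi (- x)]. *)
Context (G : R -> R).
Hypothesis dG : forall x, is_derive x 1 G (- (phi0 * expR (- (x ^+ 2 / 2)))).
Hypothesis G0 : G x @[x --> +oo] --> (0 : R).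

(** With phi the normal density, phi(y)/y - G(y) has derivative -phi(y)/y^2 and tends to 0. *)
Lemma mills_ub x : 1 <= x -> x * (expR (x ^+ 2 / 2) * G x) <= phi0.
Proof.
move=> x1; have x0 : 0 < x by exact: lt_le_trans x1.
suff : 0 <= phi0 * expR (- (x ^+ 2 / 2)) * x^-1 - G x.
  rewrite -(pmulr_rge0 _ x0) -(pmulr_rge0 _ (expR_gt0 (x ^+ 2 / 2))).
  rewrite -[X in _ -> is_true X]subr_ge0; congr (_ <= _); rewrite expRN; field.
  by rewrite !gt_eqF// expR_gt0.
apply: (@nonincreasing_cvg0_ge0 (fun y => phi0 * expR (- (y ^+ 2 / 2)) * y^-1 - G y)
  (fun y => - (phi0 * expR (- (y ^+ 2 / 2)) * (y ^+ 2)^-1))).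
- move=> y xy; have y0 : 0 < y by exact: lt_le_trans xy.
  have dV : is_derive y 1 (fun y : R => y^-1) (- y ^- 2).
    have yn : y != 0 by rewrite gt_eqF.
    have := @is_deriveV _ (fun y => y) y 1 1 yn (is_derive1_id _).
    by move=> H; apply: is_derive_eq H _; rewrite /GRing.scale /= mulr1.
  apply: is_derive_eq (is_derive1B (is_derive1M (is_derive1M (is_derive1_cst y phi0)
    (is_derive_gaussN y)) dV) (dG y)) _.
  by field; rewrite gt_eqF.
- move=> y xy; rewrite oppr_le0 !mulr_ge0// ?expR_ge0// ?ltW ?phi0_gt0//.
  by rewrite invr_gt0 exprn_gt0// (lt_le_trans x0).
- rewrite -[X in _ --> X](subr0 (0 : R)); apply: cvgB; last exact: G0.
  apply: gauss_tail_cvg0 => y y1; have y0 : 0 < y by exact: lt_le_trans y1.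
  have h : 0 < phi0 * expR (- (y ^+ 2 / 2)) :> R by rewrite mulr_gt0 ?phi0_gt0 ?expR_gt0.
  apply/andP; split; first by rewrite mulr_ge0 ?ltW// invr_gt0.
  by rewrite ler_piMr ?(ltW h)// invf_le1.
Qed.

(** Likewise G(y) - phi(y) y/(1 + y^2) has derivative -2 phi(y)/(1 + y^2)^2 and tends to 0. *)
Lemma mills_lb x : 1 <= x -> phi0 * x <= (1 + x ^+ 2) * (expR (x ^+ 2 / 2) * G x).
Proof.
move=> x1.
have p1 y : 0 < 1 + y ^+ 2 :> R by rewrite ltr_pwDl// sqr_ge0.
suff : 0 <= G x - phi0 * expR (- (x ^+ 2 / 2)) * (x * (1 + x ^+ 2)^-1).
  rewrite -(pmulr_rge0 _ (p1 x)) -(pmulr_rge0 _ (expR_gt0 (x ^+ 2 / 2))).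
  rewrite -[X in _ -> is_true X]subr_ge0; congr (_ <= _); rewrite expRN; field.
  by rewrite !gt_eqF// expR_gt0.
apply: (@nonincreasing_cvg0_ge0
  (fun y => G y - phi0 * expR (- (y ^+ 2 / 2)) * (y * (1 + y ^+ 2)^-1))
  (fun y => - (2 * phi0 * expR (- (y ^+ 2 / 2)) * ((1 + y ^+ 2) ^+ 2)^-1))).
- move=> y xy.
  have dp : is_derive y 1 (fun y : R => 1 + y ^+ 2) (2 * y).
    apply: is_derive_eq (is_derive1D (is_derive1_cst y 1)
      (is_derive1M (is_derive1_id y) (is_derive1_id y))) _.
    by ring.
  have dV : is_derive y 1 (fun y : R => (1 + y ^+ 2)^-1) (- (2 * y) / (1 + y ^+ 2) ^+ 2).
    have yn : 1 + y ^+ 2 != 0 by rewrite gt_eqF.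
    have := @is_deriveV _ (fun y : R => 1 + y ^+ 2) y _ 1 yn dp.
    by move=> H; apply: is_derive_eq H _; rewrite /GRing.scale /=; field.
  apply: is_derive_eq (is_derive1B (dG y) (is_derive1M (is_derive1M
    (is_derive1_cst y phi0) (is_derive_gaussN y)) (is_derive1M (is_derive1_id y) dV))) _.
  by field; rewrite gt_eqF.
- move=> y xy; rewrite oppr_le0 !mulr_ge0// ?expR_ge0// ?ltW ?phi0_gt0//.
  by rewrite invr_gt0 exprn_gt0.
- rewrite -[X in _ --> X](subr0 (0 : R)); apply: cvgB; first exact: G0.
  apply: gauss_tail_cvg0 => y y1; have y0 : 0 < y by exact: lt_le_trans y1.
  have h : 0 < phi0 * expR (- (y ^+ 2 / 2)) :> R by rewrite mulr_gt0 ?phi0_gt0 ?expR_gt0.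
  apply/andP; split.
    by rewrite mulr_ge0 ?ltW// mulr_gt0// invr_gt0.
  rewrite ler_piMr ?(ltW h)// ler_pdivrMr// mul1r.
  by nra.
Qed.

(** Beyond the cutoff, f' and f'' are these two quantities up to sign and a factor in [0, 1]. *)
Lemma mills_bounds x : 1 <= x ->
  `|phi0 - x * (expR (x ^+ 2 / 2) * G x)| <= phi0 /\
  `|(1 + x ^+ 2) * (expR (x ^+ 2 / 2) * G x) - phi0 * x| <= phi0.
Proof.
move=> x1; have := mills_ub x1; have := mills_lb x1.
have := @phi0_gt0 R; move: (phi0 : R) => c c0.
set M := (expR _ * _) => h1 h2.
by split; rewrite ler_norml; apply/andP; split; nra.
Qed.

End Mills.

End Calculus.

(** * Stein functions *)

Section MeanValue.
Context {R : realType}.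
Implicit Types (f g : R -> R) (x y a b h K : R).

(** Locating [c] by its distance to [x] covers both orders of [x] and [y]. *)
Lemma mean_value f f' x y : (forall z : R, is_derive z 1 f (f' z)) ->
  exists2 c, `|c - x| <= `|y - x| & f y - f x = f' c * (y - x).
Proof.
move=> df; have cf a b : {within `[a, b], continuous f}.
  by apply: derivable_within_continuous => z _; have [] := df z.
have [xy|yx] := leP x y.
  have [c] := @MVT_segment R f f' x y xy (fun z _ => df z) (cf _ _).
  rewrite in_itv/= => /andP[xc cy] E; exists c => //.
  by rewrite !ger0_norm ?subr_ge0// lerD2r.
have [c] := @MVT_segment R f f' y x (ltW yx) (fun z _ => df z) (cf _ _).
rewrite in_itv/= => /andP[yc cx] E; exists c.
  by rewrite !ler0_norm ?subr_le0// ?(ltW yx)// lerN2 lerD2r.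
by rewrite -[LHS]opprB E; ring.
Qed.

Lemma taylor2_bound f f' f'' K : (forall z : R, is_derive z 1 f (f' z)) ->
  (forall z : R, is_derive z 1 f' (f'' z)) -> (forall z, `|f'' z| <= K) ->
  forall x h, `|f (x + h) - f x - f' x * h| <= K * h ^+ 2.
Proof.
move=> df df' K2 x h.
have [c] := mean_value x (x + h) df.
rewrite (_ : x + h - x = h); last by ring.
move=> ch ->.
rewrite -mulrBl normrM.
have [e _ ->] := mean_value x c df'.
rewrite normrM -[h ^+ 2]real_normK ?num_real// expr2 mulrA.
by rewrite ler_wpM2r// ler_pM.
Qed.

Lemma bounded_segment f L : continuous f ->
  exists2 K, 0 <= K & forall x, `|x| <= L -> `|f x| <= K.
Proof.
move=> cf; have [L0|L0] := ltP L 0.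
  by exists 0 => // x xL; have := le_lt_trans xL L0; rewrite ltNge normr_ge0.
have [|c _ cmax] := @EVT_max R (fun x => `|f x|) (- L) L (ge0_cp L0).2.
  apply: continuous_subspaceT => x; apply: (@continuous_comp _ _ _ f); first exact: cf.
  exact: norm_continuous.
exists `|f c| => // x; rewrite ler_norml => xL.
by apply: cmax; rewrite in_itv.
Qed.

(** Reduces differentiability at a knot of a spline to polynomial inequalities. *)
Lemma is_derive_quadratic f x a K :
  (forall h, `|f (h + x) - f x - a * h| <= K * h ^+ 2) -> is_derive x 1 f a.
Proof.
move=> fK.
have H : h^-1 *: ((f \o shift x) (h *: 1) - f x) @[h --> 0^'] --> a.
  apply/cvgrPdist_le => e e0; near=> h.
  have h0 : h != 0 by near: h; exact: nbhs_dnbhs_neq.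
  have he : `|h| <= e / (`|K| + 1).
    by near: h; apply: dnbhs0_le; rewrite divr_gt0// ltr_wpDl.
  rewrite /= /GRing.scale /= mulr1.
  rewrite (_ : a - _ = - (h^-1 * (f (h + x) - f x - a * h))); last by field.
  rewrite normrN normrM normfV ler_pdivrMl ?normr_gt0//.
  apply: le_trans (fK h) _.
  rewrite -[h ^+ 2]real_normK ?num_real// expr2 mulrCA ler_wpM2l//.
  rewrite ler_pdivlMr ?ltr_wpDl// in he.
  by have := ler_norm K; have := normr_ge0 h; have := normr_ge0 K; nra.
by apply: DeriveDef; [apply/cvg_ex; exists a|apply/cvg_lim].
Unshelve. all: by end_near. Qed.

Definition pospart k x := Num.max (x - k) 0.

Lemma pospart_ge k x : k <= x -> pospart k x = x - k.
Proof. by move=> kx; rewrite /pospart max_l// subr_ge0. Qed.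

Lemma pospart_le k x : x <= k -> pospart k x = 0.
Proof. by move=> kx; rewrite /pospart max_r// subr_le0. Qed.

Lemma continuous_pospart k : continuous (pospart k).
Proof.
move=> x; apply: (@continuous_max R R (fun y => y - k) (fun=> 0)).
  by apply: cvgB; [exact: cvg_id|exact: cvg_cst].
exact: cvg_cst.
Qed.

Lemma is_derive_pospart2 k x :
  is_derive x 1 (fun y => pospart k y ^+ 2) (2 * pospart k x).
Proof.
apply: (@is_derive_quadratic _ _ _ 1) => h; rewrite mul1r /pospart.
by rewrite !maxEle ler_norml; case: ifP; case: ifP => h1 h2; apply/andP; split; nra.
Qed.

(** The function is the cube of [pospart k], written so that the product rule applies. *)
Lemma is_derive_pospart3 k x :
  is_derive x 1 (fun y => (y - k) * pospart k y ^+ 2) (3 * pospart k x ^+ 2).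
Proof.
apply: is_derive_eq (is_derive1M (is_derive1B (is_derive1_id x) (is_derive1_cst x k))
  (is_derive_pospart2 k x)) _.
by rewrite /pospart maxEle; case: ifP => _; ring.
Qed.

(* The primitive of a quadratic B-spline with knots a, a + d, a + 2d, a + 3d. *)
Lemma smooth_cutoff a b : a < b -> exists chi chi' chi'' : R -> R,
  [/\ forall x, is_derive x 1 chi (chi' x),
      forall x, is_derive x 1 chi' (chi'' x),
      continuous chi'' /\ (forall x, chi' x <= 0),
      forall x, x <= a -> [/\ chi x = 1, chi' x = 0 & chi'' x = 0] &
      forall x, b <= x -> [/\ chi x = 0, chi' x = 0 & chi'' x = 0]].
Proof.
move=> ab; pose d := (b - a) / 3.
have d0 : 0 < d by rewrite divr_gt0// subr_gt0.
have -> : b = a + 3 * d by rewrite /d; field.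
move: d d0 => {ab b} d d0.
have dn : d != 0 by rewrite gt_eqF.
(* Minus the third difference in the knot, with step [d]; it kills quadratic polynomials in the
   knot. *)
pose sp (P : R -> R -> R) x :=
  P a x - 3 * P (a + d) x + 3 * P (a + 2 * d) x - P (a + 3 * d) x.
have dsp P P' x : (forall k, is_derive x 1 (P k) (P' k x)) ->
    is_derive x 1 (sp P) (sp P' x).
  move=> dP; rewrite /sp.
  apply: is_derive_eq (is_derive1B (is_derive1D (is_derive1B (dP _)
   (is_derive1M (is_derive1_cst x 3) (dP _))) (is_derive1M (is_derive1_cst x 3) (dP _)))
   (dP _)) _.
  by ring.
(* Beyond the last knot [sp] of the cubes is 6 d^3, so the cutoff ends at 0. *)
exists (fun x => 1 - (6 * d ^+ 3)^-1 * sp (fun k y => (y - k) * pospart k y ^+ 2) x).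
exists (fun x => - (2 * d ^+ 3)^-1 * sp (fun k y => pospart k y ^+ 2) x).
exists (fun x => - (d ^+ 3)^-1 * sp pospart x).
split.
- move=> x; apply: is_derive_eq (is_derive1B (is_derive1_cst x 1)
    (is_derive1M (is_derive1_cst x _) (dsp _ (fun k y => 3 * pospart k y ^+ 2) x
    (fun k => is_derive_pospart3 k x)))) _.
  by rewrite /sp; field.
- move=> x; apply: is_derive_eq (is_derive1M (is_derive1_cst x _)
    (dsp _ (fun k y => 2 * pospart k y) x
    (fun k => is_derive_pospart2 k x))) _.
  by rewrite /sp; field.
- split.
  move=> x; apply: cvgM; first exact: cvg_cst.
  rewrite /sp; apply: cvgB; last exact: continuous_pospart.
  apply: cvgD.
    apply: cvgB; first exact: continuous_pospart.
    by apply: cvgM; [exact: cvg_cst|exact: continuous_pospart].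
  by apply: cvgM; [exact: cvg_cst|exact: continuous_pospart].
  move=> x; rewrite mulNr oppr_le0 mulr_ge0// ?invr_ge0.
    by rewrite mulr_ge0// exprn_ge0// ltW.
  rewrite /sp; have [x0|x0] := leP x a.
    by rewrite !pospart_le; lra.
  rewrite (pospart_ge (ltW x0)).
  have [x1|x1] := leP x (a + d).
    by rewrite !pospart_le; [nra|lra|lra|lra].
  rewrite (pospart_ge (ltW x1)).
  have [x2|x2] := leP x (a + 2 * d).
    by rewrite !pospart_le; [nra|lra|lra].
  rewrite (pospart_ge (ltW x2)).
  have [x3|x3] := leP x (a + 3 * d).
    rewrite !pospart_le; last by lra.
    have -> : (x - a) ^+ 2 - 3 * (x - (a + d)) ^+ 2 + 3 * (x - (a + 2 * d)) ^+ 2 - 0 ^+ 2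
      = (a + 3 * d - x) ^+ 2 by ring.
    exact: sqr_ge0.
  by rewrite (pospart_ge (ltW x3)); nra.
- by move=> x xa; split; rewrite /sp !pospart_le; try lra; ring.
- by move=> x xa; split; rewrite /sp !pospart_ge; try lra; field.
Qed.

End MeanValue.

(** * Stein functions of smoothed half-lines *)

Section SteinFunction.
Context {R : realType}.
Implicit Types a b c x : R.

Lemma is_derive_oneBPhi x :
  is_derive x 1 (fun y => 1 - Phi y) (- (phi0 * expR (- (x ^+ 2 / 2)))) .
Proof.
by apply: is_derive_eq (is_derive1B (is_derive1_cst x 1) (is_derive_Phi x)) _; ring.
Qed.

Lemma oneBPhi_cvgy : 1 - Phi x @[x --> +oo] --> (0 : R).
Proof.
rewrite -[X in _ --> X](subrr (1 : R)); apply: cvgB; first exact: cvg_cst.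
exact: Phi_cvgy.
Qed.

Lemma is_derive_PhiN x :
  is_derive x 1 (fun y => Phi (- y)) (- (phi0 * expR (- (x ^+ 2 / 2)))) .
Proof.
have := @is_derive1_comp _ Phi _ x _ _ (is_derive_Phi (- x)) (is_derive1N (is_derive1_id x)).
by move=> H; apply: is_derive_eq H _; rewrite sqrrN mulrN1.
Qed.

Lemma PhiN_cvgy : Phi (- x) @[x --> +oo] --> (0 : R).
Proof. by have := @Phi_cvgNy R; rewrite cvgNy_compNP. Qed.

Lemma expR_gaussK x : expR (x ^+ 2 / 2) * (phi0 * expR (- (x ^+ 2 / 2))) = phi0.
Proof. by rewrite mulrCA -expRD subrr expR0 mulr1. Qed.

(** On a segment continuity bounds f' and f''. Outside it the cutoff is constant, [f] is a multiple
    of a Mills ratio and [mills_bounds] applies. *)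
Lemma stein_function a b c : a < b -> 0 <= c <= 1 ->
  exists (f f' : R -> R) (K : R) (chi chi' : R -> R),
  [/\ (forall x, `|f' x| <= K) /\
        (forall x h, `|f (x + h) - f x - f' x * h| <= K * h ^+ 2),
      forall x, f' x - x * f x =
        phi0 * (chi x - c) + expR (x ^+ 2 / 2) * (Phi x - c) * chi' x,
      forall x, 0 <= chi x <= 1 /\ chi' x <= 0,
      forall x, x <= a -> chi x = 1 /\ chi' x = 0 &
      forall x, b <= x -> chi x = 0 /\ chi' x = 0].
Proof.
move=> ab /andP[c0 c1].
have [chi [chi' [chi'' [dchi dchi' [cchi'' chi'0] chia chib]]]] := smooth_cutoff ab.
pose f x := expR (x ^+ 2 / 2) *
  ((1 - c) * (Phi x * chi x) + c * ((1 - Phi x) * (1 - chi x))).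
pose f' x := x * f x + phi0 * (chi x - c) + expR (x ^+ 2 / 2) * (Phi x - c) * chi' x.
pose f'' x := f x + x * f' x + phi0 * chi' x +
   (x * expR (x ^+ 2 / 2) * (Phi x - c) + phi0) * chi' x +
   expR (x ^+ 2 / 2) * (Phi x - c) * chi'' x.
have df x : is_derive x 1 f (f' x).
  apply: is_derive_eq (is_derive1M (is_derive_gauss x) (is_derive1D
    (is_derive1M (is_derive1_cst x (1 - c)) (is_derive1M (is_derive_Phi x) (dchi x)))
    (is_derive1M (is_derive1_cst x c) (is_derive1M (is_derive_oneBPhi x)
      (is_derive1B (is_derive1_cst x 1) (dchi x)))))) _.
  rewrite /f' -[in RHS](expR_gaussK x) /f; ring.
have df' x : is_derive x 1 f' (f'' x).
  apply: is_derive_eq (is_derive1D (is_derive1D (is_derive1M (is_derive1_id x) (df x))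
    (is_derive1M (is_derive1_cst x phi0) (is_derive1B (dchi x) (is_derive1_cst x c))))
    (is_derive1M (is_derive1M (is_derive_gauss x)
      (is_derive1B (is_derive_Phi x) (is_derive1_cst x c))) (dchi' x))) _.
  by rewrite /f'' -[in X in (_ + X) * chi' x](expR_gaussK x); ring.
have cf' : continuous f' by move=> x; exact: is_derive1_continuous (df' x).
have cf'' : continuous f''.
  move=> x.
  have Cf := is_derive1_continuous (df x).
  have Cchi' := is_derive1_continuous (dchi' x).
  have CE := is_derive1_continuous (is_derive_gauss x).
  have CP : {for x, continuous (fun y => Phi y - c)}.
    by apply: cvgB; [exact: is_derive1_continuous (is_derive_Phi x)|exact: cvg_cst].
  have Cid : {for x, continuous (fun y : R => y)} by exact: cvg_id.
  apply: cvgD; first apply: cvgD; first apply: cvgD; first apply: cvgD.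
  - exact: Cf.
  - by apply: cvgM; [exact: Cid|exact: cf'].
  - by apply: cvgM; [exact: cvg_cst|exact: Cchi'].
  - apply: cvgM; last exact: Cchi'.
    apply: cvgD; last exact: cvg_cst.
    by apply: cvgM; [apply: cvgM; [exact: Cid|exact: CE]|exact: CP].
  - apply: cvgM; last exact: cchi''.
    by apply: cvgM; [exact: CE|exact: CP].
(* Beyond [L] the point lies outside the transition interval, and its absolute value exceeds 1 as
   the Mills bounds require. *)
pose L := Num.max (Num.max `|a| `|b|) 1.
have [K1 K10 f'K1] := bounded_segment L cf'.
have [K2 K20 f''K2] := bounded_segment L cf''.
have p0 := @phi0_gt0 R.
have tails x : L < `|x| -> `|f' x| <= phi0 /\ `|f'' x| <= phi0.
  rewrite /L !gt_max => /andP[/andP[ax bx] x1].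
  have [x0|x0] := leP 0 x.
    rewrite (ger0_norm x0) in ax bx x1.
    have [X0 X1 X2] : [/\ chi x = 0, chi' x = 0 & chi'' x = 0].
      by apply: chib; apply: ltW; exact: le_lt_trans (ler_norm _) bx.
    have [m1 m2] := mills_bounds is_derive_oneBPhi oneBPhi_cvgy (ltW x1).
    have F0 : f x = c * (expR (x ^+ 2 / 2) * (1 - Phi x)) by rewrite /f X0; ring.
    have F1 : f' x = - c * (phi0 - x * (expR (x ^+ 2 / 2) * (1 - Phi x))).
      by rewrite /f' F0 X0 X1; ring.
    have F2 : f'' x = c * ((1 + x ^+ 2) * (expR (x ^+ 2 / 2) * (1 - Phi x)) - phi0 * x).
      by rewrite /f'' F1 F0 X1 X2; ring.
    rewrite F1 F2 !normrM normrN (ger0_norm c0).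
    by split; apply: le_trans (ler_piMl _ c1) _.
  rewrite (ltr0_norm x0) in ax bx x1.
  have [X0 X1 X2] : [/\ chi x = 1, chi' x = 0 & chi'' x = 0].
    by apply: chia; have := ler_norm (- a); rewrite normrN; move: `|a| ax => ? *; lra.
  have [m1 m2] := mills_bounds is_derive_PhiN PhiN_cvgy (ltW x1).
  rewrite sqrrN opprK in m1 m2.
  have F0 : f x = (1 - c) * (expR (x ^+ 2 / 2) * Phi x) by rewrite /f X0; ring.
  have F1 : f' x = (1 - c) * (phi0 - - x * (expR (x ^+ 2 / 2) * Phi x)).
    by rewrite /f' F0 X0 X1; ring.
  have F2 : f'' x = (1 - c) * ((1 + x ^+ 2) * (expR (x ^+ 2 / 2) * Phi x) - phi0 * - x).
    by rewrite /f'' F1 F0 X1 X2; ring.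
  have c1' : `|1 - c| <= 1 by rewrite ger0_norm ?subr_ge0//; lra.
  rewrite F1 F2 !normrM.
  by split; apply: le_trans (ler_piMl _ c1') _.
pose K := phi0 + K1 + K2.
have f'K x : `|f' x| <= K.
  have [xL|xL] := leP `|x| L; first by have := f'K1 _ xL; rewrite /K; lra.
  by have [h _] := tails x xL; rewrite /K; lra.
have f''K x : `|f'' x| <= K.
  have [xL|xL] := leP `|x| L; first by have := f''K2 _ xL; rewrite /K; lra.
  by have [_ h] := tails x xL; rewrite /K; lra.
have chi_mono x y : x <= y -> chi y <= chi x.
  move=> xy; have [z _] := mean_value x y dchi.
  have := chi'0 z; rewrite -[chi y <= _]subr_le0 => h ->.
  by rewrite mulr_le0_ge0// subr_ge0.
exists f, f', K, chi, chi'; split.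
- by split=> //; exact: taylor2_bound df df' f''K.
- by move=> x; rewrite /f'; ring.
- move=> x; split=> //; apply/andP; split.
    have [xb|xb] := leP b x; first by have [-> _ _] := chib _ xb.
    by have [<- _ _] := chib b (lexx _); apply: chi_mono; exact: ltW.
  have [xa|xa] := leP x a; first by have [-> _ _] := chia _ xa.
  by have [<- _ _] := chia a (lexx _); apply: chi_mono; exact: ltW.
- by move=> x /chia[].
- by move=> x /chib[].
Qed.

(** Averaged at W, this bounds P(W <= a) - Phi(b) above by E[f'(W) - W f(W)] / phi0. It is the
    choice [c = Phi b]. *)
Lemma stein_above a b : a < b -> exists (f f' : R -> R) (K : R),
  [/\ forall x, `|f' x| <= K,
      forall x h, `|f (x + h) - f x - f' x * h| <= K * h ^+ 2 &
      forall x, phi0 * ((x <= a)%R%:R - Phi b) <= f' x - x * f x].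
Proof.
move=> ab; have cb : 0 <= Phi b <= 1 by rewrite Phi_ge0 Phi_le1.
have [f [f' [K [chi [chi' [[f'K fT] E chi01 chia chib]]]]]] := stein_function ab cb.
exists f, f', K; split=> // x; rewrite E.
have p0 := @phi0_gt0 R; have [/andP[h0 h1] h2] := chi01 x.
have h : 0 <= expR (x ^+ 2 / 2) * (Phi x - Phi b) * chi' x.
  (* chi' <= 0 vanishes beyond b, and Phi - Phi b <= 0 before b. *)
  have [xb|xb] := leP b x; first by have [_ ->] := chib _ xb; rewrite mulr0.
  rewrite mulr_le0// mulr_ge0_le0 ?expR_ge0// subr_le0.
  by apply: Phi_mono; exact: ltW.
rewrite -[leLHS]addr0; apply: lerD h.
rewrite ler_pM2l// lerD2r.
by have [xa|xa] := leP x a; [have [-> _] := chia _ xa|].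
Qed.

Lemma stein_below a b : a < b -> exists (f f' : R -> R) (K : R),
  [/\ forall x, `|f' x| <= K,
      forall x h, `|f (x + h) - f x - f' x * h| <= K * h ^+ 2 &
      forall x, f' x - x * f x <= phi0 * ((x <= b)%R%:R - Phi a)].
Proof.
move=> ab; have cb : 0 <= Phi a <= 1 by rewrite Phi_ge0 Phi_le1.
have [f [f' [K [chi [chi' [[f'K fT] E chi01 chia chib]]]]]] := stein_function ab cb.
exists f, f', K; split=> // x; rewrite E.
have p0 := @phi0_gt0 R; have [/andP[h0 h1] h2] := chi01 x.
(* [chi'] vanishes up to [a], and [Phi x - Phi a] is nonnegative afterwards. *)
have h : expR (x ^+ 2 / 2) * (Phi x - Phi a) * chi' x <= 0.
  have [xa|xa] := leP x a; first by have [_ ->] := chia _ xa; rewrite mulr0.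
  rewrite mulr_ge0_le0// mulr_ge0 ?expR_ge0// subr_ge0.
  by apply: Phi_mono; exact: ltW.
rewrite -[leRHS]addr0; apply: lerD h.
rewrite ler_pM2l// lerD2r.
by have [xb|xb] := leP x b; [|have [-> _] := chib _ (ltW xb)].
Qed.

End SteinFunction.

(** * Convergence *)

Section NormalApproximation.
Context {R : realType} {n : nat} (T : rtree n).

Lemma cdf_std_desE x :
  cdf_std_des T x = Eperm (fun w => (std_des T w <= x)%R%:R) :> R.
Proof.
rewrite /cdf_std_des /Eperm -sum1_card natr_sum big_mkcond /=; congr (_ / _).
by apply: eq_bigr => w _; rewrite inE; case: (_ <= _).
Qed.

Lemma touchdeg_maxdowndeg v : touchdeg T v <= 2 * (maxdowndeg T)%:R + 1 :> R.
Proof.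
apply: le_trans (touchdeg_le _ _) _; rewrite lerD2r mulr_natl mulr2n.
by apply: lerD; rewrite ler_nat; exact: leq_bigmax.
Qed.

Lemma var_des_lower : n.-1%:R <= 12 * var_des T :> R.
Proof.
apply: le_trans (var_des_ge T); apply: le_trans (sum_nonroot_le T).
by rewrite sumr_const cardC1 card_ord.
Qed.

End NormalApproximation.

(** * Rate of the error term and passage to the limit *)

Section Rate.
Context {R : realType} (T : forall n : nat, rtree n.+1) (C eps : R).
Hypothesis eps0 : 0 < eps.
Hypothesis eps1 : eps < 2^-1.
Hypothesis hD : forall n : nat,
  (maxdowndeg (T n))%:R <= C * ((n.+1)%:R `^ (2^-1 - eps)).

Lemma powRN_cvg0 (e : R) : 0 < e -> \forall n \near \oo, (n.+1)%:R `^ (- eps) <= e.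
Proof.
move=> e0; near=> n.
have h : (e^-1) `^ (eps^-1) <= (n.+1)%:R.
  apply: (@le_trans _ _ n%:R); last by rewrite ler_nat.
  by near: n; exact: nbhs_infty_ger.
rewrite powRN -[leRHS]invrK lef_pV2 ?posrE ?invr_gt0 ?powR_gt0//.
have -> : e^-1 = (e^-1 `^ eps^-1) `^ eps.
  by rewrite -powRrM mulVf ?gt_eqF// powRr1// invr_ge0 ltW.
by apply: ge0_ler_powR; rewrite ?nnegrE ?powR_ge0// ltW.
Unshelve. all: by end_near. Qed.

(** The numerator is of order at most n^(1/2 - eps) and the standard deviation at least of order
    n^(1/2), so the quotient is at most of order n^(-eps). *)
Lemma maxdowndeg_rate (e : R) : 0 < e -> \forall n \near \oo,
  0 < var_des (T n) :> R /\
  (2 * (maxdowndeg (T n))%:R + 1) / Num.sqrt (var_des (T n)) <= e.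
Proof.
move=> e0.
have C0 : 0 <= C.
  have := le_trans (ler0n _ _) (hD 0); rewrite pmulr_lge0// powR_gt0//.
pose c := Num.sqrt 24 * (2 * C + 1).
have c0 : 0 < c by rewrite mulr_gt0 ?sqrtr_gt0// ltr_wpDl// mulr_ge0.
near=> n.
have n1 : (0 < n)%N by near: n; exact: nbhs_infty_gt.
have he : (n.+1)%:R `^ (- eps) <= e / c.
  by near: n; apply: powRN_cvg0; rewrite divr_gt0.
set m : R := (n.+1)%:R in he *.
have m0 : 0 < m by rewrite ltr0n.
have m1 : 1 <= m by rewrite ler1n.
(* [T n] has n edges, so n <= 12 Var, and m = n + 1 <= 2n. *)
have vm : m / 24 <= var_des (T n).
  have := @var_des_lower R _ (T n); rewrite /=.
  have : m <= 2 * n%:R by rewrite /m -natrM ler_nat mul2n -addnn -addn1 leq_add2l.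
  by move=> *; lra.
have v0 : 0 < var_des (T n) :> R by apply: lt_le_trans vm; rewrite divr_gt0.
split=> //; rewrite ler_pdivrMr ?sqrtr_gt0//.
have sm : m `^ 2^-1 <= Num.sqrt 24 * Num.sqrt (var_des (T n)).
  by rewrite powR12_sqrt ?(ltW m0)// -sqrtrM// ler_wsqrtr//; lra.
have mm : m `^ (2^-1 - eps) = m `^ (- eps) * m `^ 2^-1.
  by rewrite -powRD; [rewrite addrC|rewrite (gt_eqF m0) implybT].
(* The summand 1 is absorbed because the power is at least 1, the exponent being positive. *)
have B : 2 * (maxdowndeg (T n))%:R + 1 <= (2 * C + 1) * m `^ (2^-1 - eps).
  have : 1 <= m `^ (2^-1 - eps).
    by rewrite -{1}(powRr0 m) ler_powR// subr_ge0 ltW.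
  by have := hD n; rewrite -/m; move=> *; lra.
apply: le_trans B _; rewrite mm.
apply: (@le_trans _ _ ((2 * C + 1) * (e / c * (Num.sqrt 24 * Num.sqrt (var_des (T n)))))).
  rewrite ler_wpM2l ?addr_ge0 ?mulr_ge0//.
  by rewrite ler_pM ?powR_ge0.
rewrite le_eqVlt; apply/predU1P; left; rewrite /c; field.
by rewrite !gt_eqF ?sqrtr_gt0// ltr_wpDl// mulr_ge0.
Unshelve. all: by end_near. Qed.

Lemma stein_cvg0 (f f' : R -> R) (K e : R) : 0 < e ->
  (forall x, `|f' x| <= K) ->
  (forall x h, `|f (x + h) - f x - f' x * h| <= K * h ^+ 2) ->
  \forall n \near \oo, `|Eperm (fun w => f' (std_des (T n) w) -
     std_des (T n) w * f (std_des (T n) w))| <= e.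
Proof.
move=> e0 f'K fT; have K0 : 0 <= K by apply: le_trans (f'K 0).
(* Adding 1 keeps the denominator positive when [K = 0]. *)
have d0 : 0 < e / (23 * K + 1) by rewrite divr_gt0// ltr_wpDl// mulr_ge0.
near=> n.
have [v0 hB] : 0 < var_des (T n) :> R /\
  (2 * (maxdowndeg (T n))%:R + 1) / Num.sqrt (var_des (T n)) <= e / (23 * K + 1).
  by near: n; exact: maxdowndeg_rate.
apply: le_trans (stein_bound (fun v _ => touchdeg_maxdowndeg _ v) v0 f'K fT) _.
rewrite -mulrA; apply: (@le_trans _ _ (23 * K * (e / (23 * K + 1)))).
  by rewrite ler_wpM2l// mulr_ge0.
rewrite mulrCA ler_piMr ?(ltW e0)// ler_pdivrMr ?mul1r ?lerDl//.
by rewrite ltr_wpDl// mulr_ge0.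
Unshelve. all: by end_near. Qed.

Lemma Phi_lipschitz (x d : R) : 0 <= d -> Phi (x + d) - Phi x <= phi0 * d.
Proof.
move=> d0; have [c _ ->] := mean_value x (x + d) (@is_derive_Phi R).
rewrite (_ : x + d - x = d); last by ring.
rewrite ler_wpM2r// ler_piMr ?(ltW phi0_gt0)// -[leRHS]expR0 ler_expR oppr_le0.
by rewrite divr_ge0// sqr_ge0.
Qed.

Lemma cdf_std_des_cvg (x : R) :
  cdf_std_des (T n) x @[n --> \oo] --> Phi x.
Proof.
have p0 := @phi0_gt0 R.
apply/cvgrPdist_le => e e0.
(* Shifting the argument by [d] moves [Phi] by at most e/2, the density being at most [phi0]; the
   other e/2 is left for the Stein error. Since [d] does not depend on n, [f] and [g] are fixed
   before n grows. *)
pose d := e / (2 * phi0).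
have d0 : 0 < d by rewrite divr_gt0// mulr_gt0.
have dE : phi0 * d = e / 2 by rewrite /d; field; rewrite gt_eqF.
have [f [f' [K [f'K fT fa]]]] : exists (f f' : R -> R) (K : R),
  [/\ forall x, `|f' x| <= K,
      forall x h, `|f (x + h) - f x - f' x * h| <= K * h ^+ 2 &
      forall y, phi0 * ((y <= x)%R%:R - Phi (x + d)) <= f' y - y * f y].
  by apply: stein_above; rewrite ltrDl.
have [g [g' [L [g'L gT gb]]]] : exists (f f' : R -> R) (K : R),
  [/\ forall x, `|f' x| <= K,
      forall x h, `|f (x + h) - f x - f' x * h| <= K * h ^+ 2 &
      forall y, f' y - y * f y <= phi0 * ((y <= x)%R%:R - Phi (x - d))].
  by apply: stein_below; rewrite gtrDl oppr_lt0.
have e2 : 0 < phi0 * (e / 2) by rewrite mulr_gt0// divr_gt0.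
near=> n.
have hf : `|Eperm (fun w => f' (std_des (T n) w) -
     std_des (T n) w * f (std_des (T n) w))| <= phi0 * (e / 2).
  by near: n; exact: stein_cvg0 e2 f'K fT.
have hg : `|Eperm (fun w => g' (std_des (T n) w) -
     std_des (T n) w * g (std_des (T n) w))| <= phi0 * (e / 2).
  by near: n; exact: stein_cvg0 e2 g'L gT.
have E c : Eperm (fun w => phi0 * ((std_des (T n) w <= x)%R%:R - c)) =
   phi0 * (cdf_std_des (T n) x - c).
  by rewrite EpermZ EpermB Eperm_cst cdf_std_desE.
have U : cdf_std_des (T n) x - Phi (x + d) <= e / 2.
  rewrite -(ler_pM2l p0) -E; apply: le_trans hf; apply: le_trans (ler_norm _).
  by apply: ler_Eperm => w; exact: fa.
have V : - (e / 2) <= cdf_std_des (T n) x - Phi (x - d).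
  rewrite -(ler_pM2l p0) -E mulrN; rewrite ler_norml in hg; case/andP: hg => hg _.
  apply: le_trans hg _.
  by apply: ler_Eperm => w; exact: gb.
have := Phi_lipschitz x (ltW d0); have := Phi_lipschitz (x - d) (ltW d0).
rewrite subrK dE ler_norml => h1 h2.
by apply/andP; split; lra.
Unshelve. all: by end_near. Qed.

End Rate.

Unset Implicit Arguments.

(* T n is the tree T_{n+1} with n+1 vertices. Convergence in distribution to
   N(0,1) is stated as pointwise convergence of the distribution functions
   (the limit CDF is continuous everywhere). *)
Theorem theorem3p1 (R : realType) (T : forall n : nat, rtree n.+1)
  (C eps : R) (heps0 : 0 < eps) (heps1 : eps < 2^-1)
  (hD : forall n : nat,
      (maxdowndeg (T n))%:R <= C * ((n.+1)%:R `^ (2^-1 - eps))) :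
  forall x : R,
    (fun n : nat => (cdf_std_des (T n) x)%:E) @ \oo -->
      normal_prob (0 : R) 1 `]-oo, x]%classic.
Proof.
move=> x; rewrite PhiE; apply: cvg_EFin; first exact: nearW.
exact: cdf_std_des_cvg heps0 heps1 hD x.
Qed.
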